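(* Let $n\ge 1$, $N\ge 1$, and let $X,Y_1,\dots,Y_N\in GL(n)$ be invertible $n\times n$ matrices. Then for all integers $m_1,\dots,m_N$, $$Z_{n-\sum_{i=1}^N m_i,\;m_1,\dots,m_N}\left(X,XY_1,\dots,XY_N\right)=\det(X)\,Z_{m_1,\dots,m_N}\left(Y_1,\dots,Y_N\right).$$
   Context: Matrices have entries in $\mathbb{R}$ or $\mathbb{C}$, and $I$ is the $n\times n$ identity matrix. For $n\times n$ matrices $X_1,\dots,X_k$, the generalized matrix invariants $Z_{m_1,\dots,m_k}(X_1,\dots,X_k)$ are the coefficients in the polynomial expansion, in the scalar commuting variables $\alpha_1,\dots,\alpha_k$, $$\det\Big(I+\sum_{i=1}^k\alpha_iX_i\Big)=\sum_{m_1,\dots,m_k}\alpha_1^{m_1}\cdots\alpha_k^{m_k}\,Z_{m_1,\dots,m_k}(X_1,\dots,X_k),$$ where the sum is taken over all $(m_1,\dots,m_k)\in\mathbb{Z}^k$, with $Z_{m_1,\dots,m_k}(X_1,\dots,X_k):=0$ whenever the monomial $\alpha_1^{m_1}\cdots\alpha_k^{m_k}$ does not appear in the expansion (in particular whenever some $m_i<0$). *)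

(* Defs.v *)
From mathcomp Require Import all_boot all_order all_algebra.
From mathcomp.multinomials Require Import mpoly.

Set Implicit Arguments.
Unset Strict Implicit.
Unset Printing Implicit Defensive.

Import Order.TTheory GRing.Theory Num.Theory.
Local Open Scope ring_scope.

(* det (I + \sum_i alpha_i X_i), with alpha_i the i-th indeterminate 'X_i. *)
Definition det_pencil (K : comNzRingType) (n k : nat)
    (X : k.-tuple 'M[K]_n) : {mpoly K[k]} :=
  \det (1%:M + \sum_(i < k) 'X_i *: map_mx (@mpolyC k K) (tnth X i)).

(* Exponents live in Z^k; the natural exponent `|m_i| is only used when every
   m_i is nonnegative, in which case it is m_i itself. *)
Definition Zinv (K : comNzRingType) (n k : nat)
    (m : k.-tuple int) (X : k.-tuple 'M[K]_n) : K :=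
  if all (fun z : int => 0 <= z) m
  then (det_pencil X)@_[multinom `|tnth m i|%N | i < k]
  else 0.

(* Main.v *)
(* Each entry of the pencil is a constant plus a linear form, so the part of
   [det (I + a_0 X + \sum_i a_i X Y_i)] of top degree [n] is
   [det (a_0 X + \sum_i a_i X Y_i) = det X * det (a_0 I + \sum_i a_i Y_i)].
   The exponents on the left-hand side of the theorem have sum [n], hence only
   this part matters.  The last determinant is homogeneous of degree [n], so
   setting [a_0 = 1] loses no information: the exponent of [a_0] is recovered
   from the other ones. *)
Require Import Defs.
From mathcomp Require Import all_boot all_order all_algebra.
From mathcomp Require Import perm.
From mathcomp Require Import reals.
From mathcomp Require Import complex.
From mathcomp.multinomials Require Import mpoly.

Set Implicit Arguments.
Unset Strict Implicit.
Unset Printing Implicit Defensive.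

Import Order.TTheory GRing.Theory Num.Theory.
Local Open Scope ring_scope.

Section TopDegree.

Variables (K : comNzRingType) (k : nat).

Lemma dhomog_prod_sum (I : finType) (d : I -> nat) (F : I -> {mpoly K[k]}) :
  (forall i, F i \is (d i).-homog) ->
  \prod_i F i \is (\sum_i d i)%N.-homog.
Proof.
move=> homF; elim/big_rec2: _ => [|i x y _ homy]; first exact: dhomog1.
exact: dhomogM.
Qed.

(** Expand the product over the subsets [J] of factors that contribute their linear part: the term
    of [J] is homogeneous of degree [#|J|], so only the full set reaches degree [n]. *)
Lemma mcoeff_prod_affine (n : nat) (c : 'I_n -> K)
    (l : 'I_n -> {mpoly K[k]}) (m : 'X_{1..k}) :
  (forall i, l i \is 1.-homog) -> mdeg m = n ->
  (\prod_i ((c i)%:MP + l i))@_m = (\prod_i l i)@_m.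
Proof.
move=> homl degm.
(* With [l i] written first, [bigA_distr] picks [l i] for [i] in [J] and the constant outside
   [J]. *)
under eq_bigr do rewrite addrC.
rewrite bigA_distr (bigD1 [set: 'I_n]) //= mcoeffD [X in _ + X]raddf_sum /=.
rewrite [X in _ + X]big1 ?addr0 => [|J neqJT].
  by congr (_@_m); apply: eq_bigr => i _; rewrite inE.
apply: (@dhomog_nemf_coeff _ _ mdeg (\sum_i (i \in J))%N).
  apply: dhomog_prod_sum => i; case: ifP => _ //.
  by rewrite -alg_mpolyC; apply/dhomogZ/dhomog1.
rewrite /= degm -big_mkcond sum1_card /= eq_sym; apply: contra neqJT => /eqP cardJ.
by rewrite eqEcard subsetT cardsT card_ord cardJ leqnn.
Qed.

(** Each term of the Leibniz formula is, up to sign, a product of [n] affine entries, so the product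
    case applies permutation by permutation. *)
Lemma mcoeff_det_affine (n : nat) (C : 'M[K]_n) (L : 'M[{mpoly K[k]}]_n)
    (m : 'X_{1..k}) :
  (forall i j, L i j \is 1.-homog) -> mdeg m = n ->
  (\det (map_mx (@mpolyC k K) C + L))@_m = (\det L)@_m.
Proof.
move=> homL degm; rewrite /determinant !raddf_sum /=; apply: eq_bigr => s _.
rewrite !mulr_sign -!scaler_sign !mcoeffZ; congr (_ * _).
rewrite -(mcoeff_prod_affine (fun i => C i (s i))
            (fun i => homL i (s i)) degm).
by under eq_bigr do rewrite !mxE.
Qed.

Lemma dhomog_det (n : nat) (L : 'M[{mpoly K[k]}]_n) :
  (forall i j, L i j \is 1.-homog) -> \det L \is n.-homog.
Proof.
move=> homL; apply: rpred_sum => s _.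
rewrite mulr_sign -scaler_sign; apply: dhomogZ.
by rewrite -[n in n.-homog]card_ord -sum1_card; apply: dhomog_prod_sum.
Qed.

Definition linear_pencil (n : nat) (X : 'I_k -> 'M[K]_n) :
    'M[{mpoly K[k]}]_n :=
  \sum_(i < k) 'X_i *: map_mx (@mpolyC k K) (X i).

Lemma dhomog_linear_pencil (n : nat) (X : 'I_k -> 'M[K]_n) i j :
  linear_pencil X i j \is 1.-homog.
Proof.
rewrite summxE; apply: rpred_sum => h _.
by rewrite !mxE mulrC mul_mpolyC; apply: dhomogZ; rewrite dhomogX; apply/eqP/mdeg1.
Qed.

Lemma linear_pencilM (n : nat) (A : 'M[K]_n) (X : 'I_k -> 'M[K]_n) :
  linear_pencil (fun i => A *m X i) =
  map_mx (@mpolyC k K) A *m linear_pencil X.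
Proof.
rewrite mulmx_sumr; apply: eq_bigr => i _.
by rewrite map_mxM scalemxAr.
Qed.

Lemma mcoeff_det_pencil_top (n : nat) (X : k.-tuple 'M[K]_n) (m : 'X_{1..k}) :
  mdeg m = n -> (det_pencil X)@_m = (\det (linear_pencil (tnth X)))@_m.
Proof.
move=> degm.
rewrite -(@mcoeff_det_affine n 1%:M) ?map_mx1 //.
exact: dhomog_linear_pencil.
Qed.

End TopDegree.

Section Dehomogenization.

Variables (K : comNzRingType) (N : nat).

(** The substitution a_0 = 1, with the other indeterminates shifted down by one index. *)
Definition dehomog_point : N.+1.-tuple {mpoly K[N]} :=
  [tuple of 1 :: [tuple 'X_i | i < N]].

(** Among monomials of degree [n], the exponent of a_0 is determined by the others, so setting a_0 =
    1 never merges two terms of [p]. The test guards against truncated subtraction: no monomial of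
    degree [n] has a tail of larger degree. *)
Lemma mcoeff_dehomog (n : nat) (p : {mpoly K[N.+1]}) (m : 'X_{1..N}) :
  p \is n.-homog ->
  (p \mPo dehomog_point)@_m =
  if (mdeg m <= n)%N then p@_[multinom of (n - mdeg m)%N :: m] else 0.
Proof.
move=> homp; rewrite comp_mpolyEX raddf_sum /=.
set e := [multinom of _].
(* A monomial of [p] is sent to its tail; since its degree is [n], that tail is [m] exactly when the
   monomial is [e]. *)
have tailE (u : 'X_{1..N.+1}) : u \in msupp p ->
    (('X_[u] : {mpoly K[N.+1]}) \mPo dehomog_point)@_m
    = ((mdeg m <= n)%N && (u == e))%:R.
  move=> /(dhomog_mf homp) degu.
  have -> : 'X_[u] \mPo dehomog_point
      = 'X_[K, [multinom u (lift ord0 i) | i < N]].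
    rewrite comp_mpolyX big_ord_recl tnth0 expr1n mul1r mpolyXE_id.
    by apply: eq_bigr => i _; rewrite tnthS tnth_mktuple mnmE.
  rewrite mcoeffX; congr (nat_of_bool _)%:R.
  move: degu; rewrite /= mdegE big_ord_recl => degu.
  apply/eqP/andP => [tail_u|[lemn /eqP ->]].
    have deg_m : mdeg m = (n - u ord0)%N.
      rewrite -tail_u mdegE -degu addKn.
      by apply: eq_bigr => i _; rewrite mnmE.
    split; first by rewrite deg_m leq_subr.
    apply/eqP/mnmP => i; rewrite /e; case: (unliftP ord0 i) => [j|] ->.
      by rewrite [RHS]tnthS -tail_u tnth_mktuple.
    by rewrite [RHS]tnth0 deg_m subKn // -degu leq_addr.
  by apply/mnmP => i; rewrite mnmE [LHS]tnthS.
under eq_big_seq => u /tailE cu do rewrite mcoeffZ cu.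
case: leqP => _; last by rewrite big1 // => u _; rewrite mulr0.
rewrite [p in RHS]mpolyE raddf_sum /=; apply: eq_bigr => u _.
by rewrite mcoeffZ mcoeffX.
Qed.

(** The summand a_0 I becomes the constant term I of the pencil of [Y]. *)
Lemma det_linear_pencil_dehomog (n : nat) (Y : N.-tuple 'M[K]_n) :
  \det (linear_pencil (tnth [tuple of 1%:M :: Y])) \mPo dehomog_point
  = det_pencil Y.
Proof.
rewrite -[LHS]/(comp_mpoly dehomog_point _) -det_map_mx; congr (\det _).
apply/matrixP => i j; rewrite !mxE !summxE rmorph_sum big_ord_recl /=.
rewrite tnth0 !mxE rmorphM /= comp_mpolyXU mul1r comp_mpolyC; congr (_ + _).
  by rewrite rmorph_nat.
apply: eq_bigr => h _.
rewrite !mxE tnthS rmorphM /= comp_mpolyC comp_mpolyXU -tnth_nth tnthS.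
by rewrite tnth_mktuple.
Qed.

End Dehomogenization.

Lemma Zinv_mulmx (K : comNzRingType) (n N : nat) (X : 'M[K]_n)
    (Y : N.-tuple 'M[K]_n) (m : N.-tuple int) :
  Zinv [tuple of (n%:Z - \sum_(i < N) tnth m i) :: m]
       [tuple of X :: [tuple X *m tnth Y i | i < N]]
  = \det X * Zinv m Y.
Proof.
rewrite /Zinv /=.
(* A negative m_i makes both sides 0 by convention. *)
have [m_ge0|_] := boolP (all _ m); last by rewrite andbF mulr0.
set u := [multinom `|tnth m i|%N | i < N].
have sum_m : \sum_(i < N) tnth m i = (mdeg u)%:Z.
  rewrite mdegE (big_morph Posz PoszD (erefl _)); apply: eq_bigr => i _.
  by rewrite mnmE gez0_abs //; apply: (allP m_ge0); apply: mem_tnth.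
rewrite andbT sum_m subr_ge0 lez_nat -(det_linear_pencil_dehomog Y).
rewrite (mcoeff_dehomog _ (dhomog_det (dhomog_linear_pencil _))) /=.
(* If the m_i sum to more than [n], the left side is 0 because its first exponent is negative, the
   right side for degree reasons. *)
case: leqP => [le_un|_]; last by rewrite mulr0.
set v := [multinom of _ :: u].
have -> : [multinom `|tnth [tuple of (n%:Z - (mdeg u)%:Z)%R :: m] i|%N
             | i < N.+1] = v.
  apply/mnmP => i; rewrite mnmE; case: (unliftP ord0 i) => [j|] ->.
    by rewrite tnthS [RHS]tnthS tnth_mktuple.
  by rewrite tnth0 [RHS]tnth0 subzn.
have degv : mdeg v = n.
  rewrite mdegE big_ord_recl [v ord0]tnth0.
  under eq_bigr do rewrite [v _]tnthS.
  by rewrite -mdegE subnK.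
rewrite mcoeff_det_pencil_top //.
(* Reading the head [X] as [X *m 1%:M] makes [X] a common left factor of the whole linear pencil. *)
have -> : linear_pencil (tnth [tuple of X :: [tuple X *m tnth Y i | i < N]])
    = linear_pencil (fun i => X *m tnth [tuple of 1%:M :: Y] i).
  apply: eq_bigr => i _; congr (_ *: map_mx _ _).
  case: (unliftP ord0 i) => [j|] ->; first by rewrite !tnthS tnth_mktuple.
  by rewrite !tnth0 mulmx1.
by rewrite linear_pencilM det_mulmx det_map_mx mcoeffCM.
Qed.

Theorem mainTheorem3 (R : realType) (n N : nat) (n_ge1 : (1 <= n)%N)
    (N_ge1 : (1 <= N)%N) :
  (forall (X : 'M[R]_n) (Y : N.-tuple 'M[R]_n),
     X \in unitmx -> (forall i : 'I_N, tnth Y i \in unitmx) ->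
     forall m : N.-tuple int,
       Zinv [tuple of (n%:Z - \sum_(i < N) tnth m i) :: m]
            [tuple of X :: [tuple X *m tnth Y i | i < N]]
       = \det X * Zinv m Y) /\
  (forall (X : 'M[R[i]]_n) (Y : N.-tuple 'M[R[i]]_n),
     X \in unitmx -> (forall i : 'I_N, tnth Y i \in unitmx) ->
     forall m : N.-tuple int,
       Zinv [tuple of (n%:Z - \sum_(i < N) tnth m i) :: m]
            [tuple of X :: [tuple X *m tnth Y i | i < N]]
       = \det X * Zinv m Y).
Proof.
by split=> X Y _ _ m; apply: Zinv_mulmx.
Qed.
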